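(* Let $n$ be a positive integer and let $f_1,\dots,f_n,r_1,\dots,r_n\in\mathbb{F}_2[x]$ satisfy $\deg(r_i)<\deg(f_i)$ for $1\le i\le n$. Suppose there exists a polynomial $g\in\mathbb{F}_2[x]$ satisfying none of the congruences $g\equiv r_i \pmod{f_i}$, $i=1,\dots,n$. Then there exists such a polynomial $g_0\in\mathbb{F}_2[x]$ (satisfying none of these congruences) with $\deg(g_0)<n$.
   Context: Convention: the zero polynomial is regarded as having degree $0$. A polynomial $g$ satisfies the congruence $g\equiv r\pmod f$ if $f\mid (g-r)$. *)

(* Defs.v *)
From mathcomp Require Import all_boot all_order all_algebra.

Set Implicit Arguments.
Unset Strict Implicit.
Unset Printing Implicit Defensive.

Import GRing.Theory.
Local Open Scope ring_scope.

(* [size p] is the degree plus one for [p != 0], and [size 0 = 0], so the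
   truncated predecessor gives the zero polynomial degree 0. *)
Definition deg (R : nzRingType) (p : {poly R}) : nat := (size p).-1.

Definition congp (F : fieldType) (f g r : {poly F}) : bool := f %| g - r.

(* Main.v *)
(** Let [g] avoid all the classes [r_i + (f_i)].  If a linear form [l_i] on
    [F[x]/(f_i)] does not vanish at [g - r_i], then every [w] with
    [l_i w = l_i g] avoids the [i]-th class.  The [n] equations [l_i w = l_i g]
    are solvable with [size w <= n] as soon as the [l_i] are linearly independent
    on the polynomials of size at most [n].  By Rado's theorem on independent
    transversals such [l_i] exist unless, for some set [T] of indices, the forms
    vanishing on some [(f_i)], [i] in [T], span a space of dimension less than
    [#|T|] on the polynomials of size at most [n]; then some nonzero [L] of size
    at most [#|T|] is a common multiple of the [f_i], [i] in [T].  In that case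
    one looks for the solution in the coset [g %% L + (L)], which avoids the
    classes in [T] altogether and where the other [n - #|T|] classes become
    congruence classes for [h] in [g %% L + L * h]; induction on [n] applies. *)

Require Import Defs.
From mathcomp Require Import all_boot all_order all_algebra.
From mathcomp Require Import ring.

Local Open Scope ring_scope.

Set Implicit Arguments.
Unset Strict Implicit.
Unset Printing Implicit Defensive.

Import GRing.Theory.

(* Rado's theorem, proved as Hall's: split along a critical set [T] if there is
   one, otherwise add any vector of some [A i] outside [Z] to [Z]. *)
Lemma independent_transversal (F : fieldType) (m : nat) (I : finType)
    (U : I -> 'M[F]_m) (A : I -> 'rV[F]_m -> Prop) (S : {set I}) (Z : 'M[F]_m) :
  (forall i v, A i v -> (v <= U i)%MS) ->
  (forall i (Y : 'M[F]_m), ~~ (U i <= Y)%MS ->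
     exists2 v, A i v & ~~ (v <= Y)%MS) ->
  (forall T : {set I}, T \subset S ->
     (\rank Z + #|T| <= \rank (Z + \sum_(i in T) U i)%MS)%N) ->
  exists2 a : I -> 'rV[F]_m, forall i, i \in S -> A i (a i) &
    (\rank Z + #|S| <= \rank (Z + \sum_(i in S) <<a i>>)%MS)%N.
Proof.
move=> AU AP.
have [k] := ubnP #|S|; elim: k S Z => // k IHk S Z ltSk rkS.
have [/existsP[T /and3P[sTS nT0 critT]] | noncrit] := boolP [exists T : {set I},
  [&& T \proper S, T != set0 &
      \rank (Z + \sum_(i in T) U i)%MS <= \rank Z + #|T|]%N].
  have cardS : #|S| = (#|T| + #|S :\: T|)%N.
    by rewrite -(cardsID T S) (setIidPr (proper_sub sTS)).
  have T_gt0 : (0 < #|T|)%N by rewrite card_gt0.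
  have [||b Ab rkb] := IHk T Z.
  - by rewrite -ltnS (leq_trans _ ltSk) // ltnS proper_card.
  - by move=> V sVT; apply: rkS; apply: subset_trans sVT (proper_sub sTS).
  have sbT : (Z + \sum_(i in T) <<b i>> <= Z + \sum_(i in T) U i)%MS.
    apply: addsmxS => //; apply/sumsmx_subP => i iT.
    by rewrite genmxE (sumsmx_sup i) //; apply/AU/Ab.
  (* Since [T] is critical, the transversal [b] already attains the full rank, so it may replace the
     [U i], [i] in [T], in the final span. *)
  have sTb : (Z + \sum_(i in T) U i <= Z + \sum_(i in T) <<b i>>)%MS.
    by rewrite -(geq_leqif (mxrank_leqif_sup sbT)) (leq_trans critT).
  have [||c Ac rkc] := IHk (S :\: T) (Z + \sum_(i in T) U i)%MS.
  - by move: ltSk; rewrite cardS !ltnS; apply: leq_trans; rewrite -add1n leq_add2r.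
  - move=> V; rewrite subsetD => /andP[sVS dVT].
    (* The rank condition for [T :|: V], less the rank taken up by the critical [T], is the
       condition for [V] over the enlarged [Z]. *)
    have /rkS : T :|: V \subset S by rewrite subUset (proper_sub sTS).
    rewrite cardsU disjoint_setI0 1?disjoint_sym // cards0 subn0 addnA.
    move=> rkTV; apply: leq_trans (leq_trans _ rkTV) _; first by rewrite leq_add2r.
    apply: mxrankS; rewrite -addsmxA; apply: addsmxS => //.
    apply/sumsmx_subP => i; rewrite inE => /orP[iT | iV].
      by rewrite (submx_trans _ (addsmxSl _ _)) // (sumsmx_sup i).
    by rewrite (submx_trans _ (addsmxSr _ _)) // (sumsmx_sup i).
  exists (fun i => if i \in T then b i else c i) => [i iS|].
    by case: ifPn => iT; [exact: Ab | apply: Ac; rewrite inE iT].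
  rewrite cardS addnA (leq_trans _ (leq_trans rkc _)) //.
    by rewrite leq_add2r (leq_trans rkb) // mxrankS.
  apply: mxrankS; rewrite [X in (_ <= _ + X)%MS](big_setID T) /=.
  rewrite (setIidPr (proper_sub sTS)) addsmxA.
  apply: addsmxS.
    apply: submx_trans sTb _; apply: addsmxS => //.
    by under [X in (_ <= X)%MS]eq_bigr => i iT do rewrite iT.
  apply/sumsmx_subP => i; rewrite inE => /andP[iT iS].
  by rewrite (sumsmx_sup i) ?inE ?iT // (negPf iT).
have [-> | [i iS]] := set_0Vmem S.
  exists (fun _ => 0) => [i|]; first by rewrite inE.
  by rewrite cards0 addn0 mxrankS // addsmxSl.
have /AP[v Av nvZ] : ~~ (U i <= Z)%MS.
  apply: contraL (rkS [set i] _) => [sUZ|]; last by rewrite sub1set.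
  by rewrite big_set1 cards1 addn1 -ltnNge ltnS mxrankS // addsmx_sub submx_refl.
have rkZv : (\rank Z < \rank (Z + v)%MS)%N.
  by rewrite (ltn_leqif (mxrank_leqif_sup (addsmxSl _ _))) addsmx_sub submx_refl.
have rkZv1 : (\rank (Z + v)%MS <= (\rank Z).+1)%N.
  by rewrite (leq_trans (mxrank_adds_leqif _ _)) // -[X in (_ <= X)%N]addn1 leq_add2l rank_leq_row.
have [||c Ac rkc] := IHk (S :\ i) (Z + v)%MS.
- by rewrite -ltnS (leq_trans _ ltSk) // ltnS (cardsD1 i S) iS.
- move=> T sTSi; have [->|nT0] := eqVneq T set0.
    by rewrite cards0 addn0 mxrankS // addsmxSl.
  have pTS : T \proper S by apply: sub_proper_trans sTSi (properD1 iS).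
  (* A nonempty noncritical set has one dimension to spare, which pays for adding [v] to [Z]. *)
  move: noncrit; rewrite negb_exists => /forallP/(_ T).
  rewrite pTS nT0 /= -ltnNge => rkT.
  rewrite (leq_trans (leq_add rkZv1 (leqnn _))) // addSn.
  by apply: leq_trans rkT (mxrankS _); rewrite addsmxS // addsmxSl.
exists (fun j => if j == i then v else c j) => [j jS|].
  by case: eqVneq => [->|ji] //; apply: Ac; rewrite !inE ji.
rewrite (cardsD1 i S) iS addnA addn1 (leq_trans _ (leq_trans rkc _)) //.
  by rewrite leq_add2r.
apply: mxrankS; rewrite [X in (_ <= _ + X)%MS](big_setD1 i) //= eqxx addsmxA; apply: addsmxS.
  by apply: addsmxS => //; rewrite genmxE.
apply/sumsmx_subP => j; rewrite !inE => /andP[ji jS].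
by rewrite (sumsmx_sup j) ?inE ?ji // (negPf ji).
Qed.

(* When the congruence has no solution in the coset, any class that misses [q]
   will do; [X] and [q - 1] provide one. *)
Lemma congruence_on_coset (F : fieldType) (f r L g q : {poly F}) :
  f != 0 -> ~~ (f %| g + L * q - r) ->
  exists2 e : {poly F} * {poly F}, e.1 != 0 /\ ~~ (e.1 %| q - e.2) &
    forall h, ~~ (e.1 %| h - e.2) -> ~~ (f %| g + L * h - r).
Proof.
move=> f0 nq; have [[u v] /= uvE] := Bezoutp f L.
set E := u * f + v * L in uvE.
have Ef : E %| f by rewrite (eqp_dvdl _ uvE) dvdp_gcdl.
have EL : E %| L by rewrite (eqp_dvdl _ uvE) dvdp_gcdr.
pose h0 := v * ((r - g) %/ E).
(* By Bezout, [h0] solves the congruence whenever any [h] does, so this splits on solvability. The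
   solutions then form the class of [h0] modulo [f %/ gcdp f L]. *)
have [solv | nsolv] := boolP (f %| g + L * h0 - r).
  have eqv h : (f %/ gcdp f L %| h - h0) -> f %| g + L * h - r.
    move=> dv.
    have -> : g + L * h - r = L * (h - h0) + (g + L * h0 - r) by ring.
    rewrite dvdp_add // -[X in X %| _](divpK (dvdp_gcdl f L)) mulrC.
    by rewrite dvdp_mul // dvdp_gcdr.
  have veq h : f %| g + L * h - r -> (f %/ gcdp f L %| h - h0).
    move=> dv.
    have : f %| L * (h - h0).
      have -> : L * (h - h0) = (g + L * h - r) - (g + L * h0 - r) by ring.
      by rewrite dvdp_sub.
    have e0 : gcdp f L != 0 by rewrite gcdp_eq0 (negPf f0).
    rewrite -{1}(divpK (dvdp_gcdl f L)) -[X in _ %| X * _](divpK (dvdp_gcdr f L)).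
    rewrite [_ %/ _ * _ * _]mulrAC dvdp_mul2r // Gauss_dvdpr //.
    by rewrite coprimep_div_gcd // f0.
  exists (f %/ gcdp f L, h0) => /=; last by move=> h; apply: contra; exact: veq.
  split; last by apply: contra nq; exact: eqv.
  by rewrite dvdp_div_eq0 ?dvdp_gcdl.
exists ('X, q - 1) => /=.
  rewrite polyX_eq0; split=> //; rewrite opprB addrC subrK.
  by rewrite dvdp1 size_polyX.
move=> h _; apply: contra nsolv => dv.
have Erg : E %| r - g.
  have -> : r - g = L * h - (g + L * h - r) by ring.
  by apply: dvdp_sub; [exact: dvdp_mulr | exact: dvdp_trans dv].
have -> : g + L * h0 - r = - (u * ((r - g) %/ E)) * f.
  have eqE : E * ((r - g) %/ E) = r - g by rewrite mulrC divpK.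
  have -> : g + L * h0 - r = L * h0 - (r - g) by ring.
  rewrite /h0; move: ((r - g) %/ E) eqE => c <-; rewrite /E; ring.
by rewrite dvdp_mull.
Qed.

(* The rows span the restrictions to polynomials of size at most [n] of the
   linear forms vanishing on the multiples of [f]. *)
Definition residue_mx (F : fieldType) (n : nat) (f : {poly F}) :
    'M[F]_(size f, n) :=
  \matrix_(j, k) ('X^k %% f)`_j.

Definition residue (F : fieldType) (f g : {poly F}) : 'cV[F]_(size f) :=
  \col_j (g %% f)`_j.

Lemma residueB (F : fieldType) (f g h : {poly F}) :
  residue f (g - h) = residue f g - residue f h.
Proof. by apply/colP => j; rewrite !mxE modpD modpN coefB. Qed.

Lemma residue_eq0 (F : fieldType) (f g : {poly F}) :
  f != 0 -> (residue f g == 0) = (f %| g).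
Proof.
move=> f0; apply/eqP/idP => [res0|/eqP modfg0]; last first.
  by apply/colP => j; rewrite !mxE modfg0 coef0.
apply/eqP/polyP => j; rewrite coef0.
have [lejf | ltjf] := leqP (size f) j.
  by rewrite nth_default // (leq_trans _ lejf) // ltnW // ltn_modp.
by have /colP/(_ (Ordinal ltjf)) := res0; rewrite !mxE.
Qed.

Lemma residue_mxE (F : fieldType) (n : nat) (f : {poly F}) (w : 'cV[F]_n) :
  residue_mx n f *m w = residue f (rVpoly w^T).
Proof.
apply/colP => j; rewrite !mxE /rVpoly poly_def.
rewrite (big_morph (fun p => p %% f) (modpD f) (mod0p f)) coef_sum.
by apply: eq_bigr => k _; rewrite valK modpZl coefZ !mxE mulrC.
Qed.

(** The subset [S] serves the induction, which passes to [S :\: T] with new moduli and residues over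
    the same index type. *)
Lemma avoid_congruences (F : fieldType) (I : finType) (S : {set I})
    (f r : I -> {poly F}) (g : {poly F}) :
  (forall i, i \in S -> f i != 0) ->
  (forall i, i \in S -> ~~ (f i %| g - r i)) ->
  exists2 g0 : {poly F}, forall i, i \in S -> ~~ (f i %| g0 - r i) &
    (size g0 <= #|S|)%N.
Proof.
have [k] := ubnP #|S|; elim: k S f r g => // k IHk S f r g ltSk f0 ng.
pose n := #|S|; pose U i := <<residue_mx n (f i)>>%MS.
have [rkS | ] := boolP [forall T : {set I}, (T \subset S) ==>
    (#|T| <= \rank (\sum_(i in T) U i)%MS)%N].
  (* Restrictions of the forms [d] that do not vanish at [g - r i]. Outside [S] all of [U i] is
     allowed, so that the hypotheses on [A] hold at every index. *)
  pose A i (v : 'rV[F]_n) := if i \in S then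
    exists2 d : 'rV_(size (f i)), v = d *m residue_mx n (f i) &
      d *m residue (f i) (g - r i) != 0 else (v <= U i)%MS.
  have [||T sTS|a Aa] := @independent_transversal F n I U A S 0.
  - move=> i v; rewrite /A; case: ifP => // _ [d -> _].
    by rewrite genmxE submxMl.
  - move=> i Y; rewrite genmxE => /row_subPn[j nRY]; rewrite /A.
    have [iS|_] := boolP (i \in S); last first.
      by exists (row j (residue_mx n (f i))); rewrite // genmxE row_sub.
    move: nRY; rewrite rowE; set d := delta_mx 0 j => nRY.
    have [da0 | da] := eqVneq (d *m residue (f i) (g - r i)) 0; last first.
      by exists (d *m residue_mx n (f i)) => //; exists d.
    have [l al] : exists l, residue (f i) (g - r i) l 0 != 0.
      have /eqP nz : residue (f i) (g - r i) != 0 by rewrite residue_eq0 ?ng ?f0.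
      apply/existsP; apply: contra_notT nz => /existsPn a0; apply/colP => l.
      by rewrite [RHS]mxE; apply/eqP; have := a0 l; rewrite negbK.
    (* If [d] vanishes at [g - r i] but [e] does not, then [e] and [d + e] are both admissible, and
       they cannot both restrict into [Y], since [d] does not. *)
    pose e := delta_mx 0 l : 'rV[F]_(size (f i)).
    have ea : e *m residue (f i) (g - r i) != 0.
      apply: contra al => /eqP/matrixP/(_ 0 0).
      by rewrite -rowE !mxE => ->.
    have [eY | neY] := boolP (e *m residue_mx n (f i) <= Y)%MS; last first.
      by exists (e *m residue_mx n (f i)) => //; exists e.
    exists ((d + e) *m residue_mx n (f i)).
      by exists (d + e) => //; rewrite mulmxDl da0 add0r.
    by apply: contra nRY => deY; rewrite -(addrK e d) mulmxBl addmx_sub ?eqmx_opp.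
  - rewrite mxrank0 add0n (leq_trans (implyP (forallP rkS T) sTS)) //.
    by rewrite mxrankS // addsmxSr.
  rewrite mxrank0 add0n => rka.
  pose C : 'M[F]_n := \matrix_(l < n) a (enum_val l).
  have Cu : C \in unitmx.
    rewrite -row_full_unit /row_full eqn_leq rank_leq_col (leq_trans rka) //.
    apply: mxrankS; rewrite addsmx_sub sub0mx; apply/sumsmx_subP => i iS.
    rewrite genmxE -(enum_rankK_in iS iS).
    by rewrite -(rowK (fun l : 'I_n => a (enum_val l))) row_sub.
  have [d dP] : exists d : forall i, 'rV[F]_(size (f i)), forall i, i \in S ->
      a i = d i *m residue_mx n (f i) /\ d i *m residue (f i) (g - r i) != 0.
    apply: (@fin_all_exists _ _ (fun i d => i \in S ->
      a i = d *m residue_mx n (f i) /\ d *m residue (f i) (g - r i) != 0)) => i.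
    case: (boolP (i \in S)) => [iS | _]; last by exists 0.
    by have := Aa i iS; rewrite /A iS => -[d ad da]; exists d.
  pose b : 'cV[F]_n := \col_l (d (enum_val l) *m residue (f (enum_val l)) g) 0 0.
  pose w := invmx C *m b.
  exists (rVpoly w^T); last exact: size_poly.
  (* If [f i] divided [w - r i], then [d i] would take equal values at [w], [r i] and [g], hence
     vanish at [g - r i]. *)
  move=> i iS; have [ai] := dP i iS; apply: contra.
  rewrite -residue_eq0 ?f0 // !residueB subr_eq0 -residue_mxE => /eqP <-.
  rewrite mulmxBr mulmxA -ai subr_eq0; apply/eqP.
  have : row (enum_rank_in iS i) (C *m w) = row (enum_rank_in iS i) b.
    by rewrite /w mulKVmx.
  rewrite row_mul rowK enum_rankK_in // => ->.
  by apply/matrixP => x y; rewrite !ord1 !mxE enum_rankK_in // !mxE.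
rewrite negb_forall => /existsP[T]; rewrite negb_imply -ltnNge => /andP[sTS rkT].
have [L L0 [szL fL]] : exists2 L : {poly F}, L != 0 &
    (size L <= #|T|)%N /\ forall i, i \in T -> f i %| L.
  (* Multiplying by [pid_mx] restricts the forms to size at most [#|T|]. The rank stays below
     [#|T|], so they have a common nonzero zero. *)
  pose M := ((\sum_(i in T) U i)%MS *m (pid_mx #|T| : 'M[F]_(n, #|T|)))%R.
  have : cokermx M != 0.
    rewrite cokermx_eq0 /row_full neq_ltn.
    by rewrite (leq_ltn_trans (mxrankM_maxl _ _) rkT).
  rewrite -trmx_eq0 => /rowV0Pn[u /submxP[D uD] u0].
  have Mu : M *m u^T = 0.
    by rewrite uD trmx_mul trmxK mulmxA mulmx_coker mul0mx.
  exists (rVpoly u).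
    by apply: contraNneq u0 => Lu0; rewrite -[u]rVpolyK Lu0 linear0.
  split=> [|i iT]; first exact: size_poly.
  rewrite -residue_eq0 ?f0 ?(subsetP sTS) // -[u]trmxK -residue_mxE.
  have -> : residue_mx #|T| (f i) = residue_mx n (f i) *m pid_mx #|T|.
    apply/matrixP => j l; rewrite !mxE.
    rewrite (bigD1 (widen_ord (subset_leq_card sTS) l)) //= big1 => [|x xl].
      by rewrite !mxE /= eqxx ltn_ord mulr1 addr0.
    rewrite [pid_mx _ _ _]mxE (_ : (x == l :> nat) = false) ?mulr0 //.
    by apply: contraNF xl => /eqP xl; apply/eqP/val_inj.
  have /submxP[D' ->] : (residue_mx n (f i) <= \sum_(i in T) U i)%MS.
    by rewrite (sumsmx_sup i) // genmxE.
  by rewrite -mulmxA -mulmxA [X in D' *m X]mulmxA Mu mulmx0.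
have cardS : #|S| = (#|T| + #|S :\: T|)%N.
  by rewrite -(cardsID T S) (setIidPr sTS).
have T_gt0 : (0 < #|T|)%N by apply: leq_ltn_trans rkT.
(* As [g] is [g %% L + L * (g %/ L)], the quotient [g %/ L] avoids all the new classes, as the
   induction requires. *)
have [e eP] : exists e : I -> {poly F} * {poly F}, forall i, i \in S ->
    ((e i).1 != 0 /\ ~~ ((e i).1 %| g %/ L - (e i).2)) /\
    forall h, ~~ ((e i).1 %| h - (e i).2) -> ~~ (f i %| g %% L + L * h - r i).
  apply: (@fin_all_exists _ _ (fun i e => i \in S ->
    (e.1 != 0 /\ ~~ (e.1 %| g %/ L - e.2)) /\
    forall h, ~~ (e.1 %| h - e.2) -> ~~ (f i %| g %% L + L * h - r i))) => i.
  case: (boolP (i \in S)) => [iS | _]; last by exists 0.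
  have [||e e1 e2] := @congruence_on_coset F (f i) (r i) L (g %% L) (g %/ L).
  - exact: f0.
  - by rewrite [_ %% _ + _]addrC [L * _]mulrC -divp_eq ng.
  by exists e.
have [|i|i|h hP szh] := IHk (S :\: T) (fun i => (e i).1) (fun i => (e i).2) (g %/ L).
- by move: ltSk; rewrite cardS !ltnS; apply: leq_trans; rewrite -add1n leq_add2r.
- by rewrite inE => /andP[_ /eP[[]]].
- by rewrite inE => /andP[_ /eP[[]]].
exists (g %% L + L * h) => [i iS|].
  have [iT|iT] := boolP (i \in T); last first.
    by have [_] := eP i iS; apply; apply: hP; rewrite inE iT.
  (* For [i] in [T], [f i] divides [L], so the new polynomial is congruent to [g] modulo [f i]. *)
  apply: contra (ng i iS) => dv; rewrite (divp_eq g L).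
  have -> : g %/ L * L + g %% L - r i =
    (g %/ L - h) * L + (g %% L + L * h - r i) by ring.
  by rewrite dvdp_add // dvdp_mull // fL.
rewrite (leq_trans (size_polyD _ _)) // geq_max; apply/andP; split.
  by rewrite cardS (leq_trans (ltnW _) (leq_trans szL (leq_addr _ _))) // ltn_modp.
rewrite (leq_trans (size_polyMleq _ _)) // cardS.
by rewrite (leq_trans (leq_pred _)) // leq_add.
Qed.

Theorem theorem1 (n : nat) (hn : (0 < n)%N) (f r : 'I_n -> {poly 'F_2})
    (hdeg : forall i : 'I_n, (deg (r i) < deg (f i))%N)
    (hg : exists g : {poly 'F_2}, forall i : 'I_n, ~ congp (f i) g (r i)) :
  exists g0 : {poly 'F_2},
    (forall i : 'I_n, ~ congp (f i) g0 (r i)) /\ (deg g0 < n)%N.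
Proof.
have [g ng] := hg.
have [i _|i _|g0 ng0] := @avoid_congruences _ _ [set: 'I_n] f r g.
(* The degree hypothesis rules out [f i = 0], whose degree is 0. *)
- by apply: contraTneq (hdeg i) => ->; rewrite /deg size_poly0 ltn0.
- exact/negP/ng.
rewrite cardsT card_ord => szg0; exists g0; split=> [i|].
  by apply/negP/ng0; rewrite inE.
(* For [g0 = 0] the degree is 0, and the bound is [hn]. *)
by rewrite /deg; case: (size g0) szg0.
Qed.
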